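(* Fix a Mellin moment $z$ and an integer $n\geqslant1$. Let $\lambda_{(n)},\phi_{(n)}$ be the coefficient functions of the second-order evolution equation built from the N$^{n-1}$LO truncation, i.e. from $\gamma^{[1]},\dots,\gamma^{[n]}$ and $\beta_0,\dots,\beta_{n-1}$ (see context). Then $$\lambda_{(n+1)}(a_s)-\lambda_{(n)}(a_s)=O(a_s^n),\qquad \phi_{(n+1)}(a_s)-\phi_{(n)}(a_s)=O(a_s^n).$$ Consequently, at N$^{n-1}$LO the expansion coefficients $l_k,p_k$ with $k<n$ are exact (equal to those of the all-orders $\gamma$ and $\beta$), while those with $k\geqslant n$ are only partially known; the Frobenius coefficients satisfy $$A_i^{\mathrm{N}^{n-1}\mathrm{LO}}=A_i^{\mathrm{exact}}\quad(0\leqslant i\leqslant n-1),\qquad A_n^{\mathrm{N}^{n-1}\mathrm{LO}}\neq A_n^{\mathrm{exact}},$$ so each new order determines exactly one more coefficient of the series; and the indices $R_\pm$, which are built from $l_0$ and $p_0$ alone, are fixed at leading order, exactly, to all orders. Moreover, if $\delta l_n,\delta p_n,\delta A_n$ denote the changes of $l_n,p_n,A_n$ when the next order becomes available (truncation $(n+1)$ minus truncation $(n)$), then for each of the two solutions, with $R=R_\pm$, $$\frac{\delta A_n}{A_0}=-\frac{R\,\delta l_n+\delta p_n}{F(R+n)},\qquad F(R_\pm+n)=n\big(n\pm(R_+-R_-)\big),$$ with $\delta l_n,\delta p_n$ linear in the unknowns $\gamma^{[n+1]}$ and $\beta_n$.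
   Context: The QCD coupling $a_s$ satisfies $da_s/d\ln\mu^2=\beta(a_s)=-\sum_{k\geqslant0}\beta_ka_s^{k+2}$ with $\beta_0>0$, and the singlet-gluon evolution kernel of QCD in Mellin space is the $2\times2$ matrix $\gamma=\sum_{k\geqslant1}a_s^k\gamma^{[k]}(z)$ with entries $\gamma_{qq},\gamma_{qg},\gamma_{gq},\gamma_{gg}$, whose leading off-diagonal entries are nonzero. For the all-orders $\gamma,\beta$ (''exact'') or for a truncation of them, define (for the $qq$ row; the other row follows by $q\leftrightarrow g$) $$\Lambda=\gamma_{gg}-\gamma_{qq}+\frac{\beta\,\dot\gamma_{qg}}{\gamma_{qg}},\qquad \lambda(a_s)=a_s\frac{\dot\beta-\Lambda}{\beta},\qquad \phi(a_s)=-a_s^2\frac{\gamma_{qg}\gamma_{gq}}{\beta^2},$$ with dots denoting $d/da_s$. The evolution equation is $\ddot u+\frac{\lambda(a_s)}{a_s}\dot u+\frac{\phi(a_s)}{a_s^2}u=0$. Expand $\lambda=\sum_{k\geqslant0}l_ka_s^k$ and $\phi=\sum_{k\geqslant0}p_ka_s^k$. The indicial polynomial is $F(x)=x(x-1)+l_0x+p_0=(x-R_+)(x-R_-)$, and the Frobenius solution $u=a_s^R\sum_{i\geqslant0}A_ia_s^i$ with $R\in\{R_+,R_-\}$ has coefficients $A_0=1$, $A_m=-\frac1{F(R+m)}\sum_{k=1}^m[\,l_k(R+m-k)+p_k\,]A_{m-k}$. The recursion for the smaller index fails at the isolated moments where $R_+-R_-$ is a positive integer; the coefficients are considered away from those moments.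 The superscript N$^{n-1}$LO refers to the truncation $(n)$, the superscript ''exact'' to the all-orders $\gamma$ and $\beta$.
   Formalization: The inequality of A_n at N^{n-1}LO and A_n exact fails for some data (e.g. γ^{[n+1]}=0 and β_n=0); it is stated instead as: the two differ exactly when a certain not identically zero linear form in γ^{[n+1]}, β_n does not vanish. *)

(* Defs.v *)
From HB Require Import structures.
From mathcomp Require Import all_boot all_order all_algebra.
From mathcomp Require Import all_classical all_reals all_analysis.

Set Implicit Arguments.
Unset Strict Implicit.
Unset Printing Implicit Defensive.

Import Order.TTheory GRing.Theory Num.Theory numFieldNormedType.Exports.
Local Open Scope ring_scope.

(* The complex numbers enter as an arbitrary                                  *)
(* [C : numClosedFieldType]; [R[i]] for [R : realType] is the intended one.   *)

(** Course-of-values recursion: [step m f] computes the value at [m] from the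
    values [f i] with [i < m]. *)
Section CourseOfValues.
Variables (T : Type) (x0 : T) (step : nat -> (nat -> T) -> T).

Fixpoint cov_seq (m : nat) : seq T :=
  if m is m'.+1 then let s := cov_seq m' in rcons s (step m' (nth x0 s))
  else [::].

Definition cov (m : nat) : T := step m (nth x0 (cov_seq m)).

Hypothesis step_ext : forall m f g,
  (forall i, (i < m)%N -> f i = g i) -> step m f = step m g.

Lemma size_cov_seq m : size (cov_seq m) = m.
Proof. by elim: m => //= m IHm; rewrite size_rcons IHm. Qed.

Lemma nth_cov_seq m i : (i < m)%N -> nth x0 (cov_seq m) i = cov i.
Proof.
elim: m => //= m IHm; rewrite ltnS leq_eqVlt nth_rcons size_cov_seq.
by case/orP => [/eqP->|lt_im]; rewrite ?ltnn ?eqxx // lt_im IHm.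
Qed.

Lemma covE m : cov m = step m cov.
Proof. by apply: step_ext => i; apply: nth_cov_seq. Qed.

End CourseOfValues.

(** Formal Laurent series: [Laurent v f] stands for
    [\sum_(k >= 0) f k a^(v + k)].  The representation is not unique, so
    series are only ever compared through their coefficients [lcoef]. *)
Record laurent (C : Type) := Laurent { lshift : int; lbody : nat -> C }.

Section Laurent.
Variable C : fieldType.
Implicit Types f g : laurent C.

Definition lcoef f (i : int) : C :=
  if lshift f <= i then lbody f `|i - lshift f|%N else 0.

Definition ladd f g : laurent C :=
  let v := Num.min (lshift f) (lshift g) in
  Laurent v (fun k => lcoef f (v + k%:Z) + lcoef g (v + k%:Z)).

Definition lopp f : laurent C := Laurent (lshift f) (fun k => - lbody f k).

Definition lmul f g : laurent C :=
  Laurent (lshift f + lshift g)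
    (fun k => \sum_(i < k.+1) lbody f i * lbody g (k - i)%N).

(* Coefficients of [1 / \sum_k b k a^k]; meaningful only if [b 0 != 0].       *)
Definition inv_body (b : nat -> C) : nat -> C :=
  cov 0 (fun m c => if m is 0 then (b 0%N)^-1
                    else - (b 0%N)^-1 * \sum_(1 <= k < m.+1) b k * c (m - k)%N).

(* Meaningful only if the leading coefficient [lbody f 0] is nonzero.         *)
Definition linv f : laurent C := Laurent (- lshift f) (inv_body (lbody f)).

Definition lderiv f : laurent C :=
  Laurent (lshift f - 1) (fun k => (lshift f + k%:Z)%:~R * lbody f k).

Definition lvar : laurent C := Laurent 1 (fun k => (k == 0%N)%:R).

Arguments inv_body : simpl never.

Lemma inv_bodyE b m : inv_body b m =
  if m is 0 then (b 0%N)^-1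
  else - (b 0%N)^-1 * \sum_(1 <= k < m.+1) b k * inv_body b (m - k)%N.
Proof.
rewrite /inv_body covE //; case=> // {}m f g eq_fg; congr (_ * _).
apply: eq_big_nat => k /andP[k_gt0 _]; rewrite eq_fg //.
by rewrite ltn_subrL k_gt0.
Qed.

Lemma lmul_linv f i : lbody f 0%N != 0 -> lcoef (lmul f (linv f)) i = (i == 0)%:R.
Proof.
move=> f0; rewrite /lcoef /= subrr subr0.
case: i => [[|i]|i] //=.
  by rewrite big_ord_recl big_ord0 addr0 divff.
rewrite big_ord_recl /= subn0 inv_bodyE mulrA mulrN mulfV // mulN1r addrC.
by apply/eqP; rewrite subr_eq0 big_add1 big_mkord.
Qed.

End Laurent.

Declare Scope laurent_scope.
Delimit Scope laurent_scope with Lau.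
Infix "+" := ladd : laurent_scope.
Notation "- f" := (lopp f) : laurent_scope.
Notation "f - g" := (ladd f (lopp g)) : laurent_scope.
Infix "*" := lmul : laurent_scope.
Notation "f / g" := (lmul f (linv g)) : laurent_scope.

(** Perturbative data at a fixed Mellin moment:
      gamma = \sum_k a^(k+1) gam k   (so [gam k] is gamma^[k+1]),
      beta  = - \sum_k bet k a^(k+2).
    Rows and columns are indexed by q = 0 and g = 1 in ['I_2]. *)
Record pert (C : Type) := Pert { gam : nat -> 'M[C]_2; bet : nat -> C }.

Section Evolution.
Variable C : numClosedFieldType.
Implicit Types (D : pert C) (r : 'I_2).

(* The other parton: [other] exchanges q and g.                               *)
Definition other r : 'I_2 := rev_ord r.

(* N^(n-1)LO: gamma^[1], ..., gamma^[n] and beta_0, ..., beta_(n-1) are kept. *)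
Definition trunc (n : nat) D : pert C :=
  Pert (fun k => if (k < n)%N then gam D k else 0)
       (fun k => if (k < n)%N then bet D k else 0).

(** The truncated gamma and beta as functions of the coupling [a], and the
    resulting coefficient functions of the evolution equation for row [r]. *)
Definition gamF n D (i j : 'I_2) (a : C) : C :=
  \sum_(k < n) a ^+ k.+1 * gam D k i j.

Definition betF n D (a : C) : C := - \sum_(k < n) bet D k * a ^+ k.+2.

Definition LambdaF n D r (a : C) : C :=
  gamF n D (other r) (other r) a - gamF n D r r a
  + betF n D a * derive1 (gamF n D r (other r)) a / gamF n D r (other r) a.

Definition lambdaF n D r (a : C) : C :=
  a * ((derive1 (betF n D) a - LambdaF n D r a) / betF n D a).

Definition phiF n D r (a : C) : C :=
  - a ^+ 2 * (gamF n D r (other r) a * gamF n D (other r) r a / betF n D a ^+ 2).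

(* [f = O(a^n)] as [a -> 0]; at [a = 0] itself beta vanishes, so the punctured *)
(* neighbourhoods are the relevant ones.                                      *)
Definition is_O (n : nat) (f : C -> C) : Prop :=
  let at0 := (0 : C)^'%classic in f =O_at0 (fun a => a ^+ n).

(** The same quantities as formal series in the coupling; this is how the
    all-orders gamma and beta, which are perturbation series, are treated. *)
Definition gamL D (i j : 'I_2) : laurent C := Laurent 1 (fun k => gam D k i j).

Definition betL D : laurent C := Laurent 2 (fun k => - bet D k).

Definition LambdaL D r : laurent C :=
  (gamL D (other r) (other r) - gamL D r r
   + betL D * lderiv (gamL D r (other r)) / gamL D r (other r))%Lau.

Definition lambdaL D r : laurent C :=
  (lvar C * ((lderiv (betL D) - LambdaL D r) / betL D))%Lau.

Definition phiL D r : laurent C :=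
  (- (lvar C * lvar C)
   * (gamL D r (other r) * gamL D (other r) r / (betL D * betL D)))%Lau.

(* When [bet D 0] and the off-diagonal entries of [gam D 0] are nonzero, these *)
(* series have no negative powers.                                            *)
Definition lco D r (k : nat) : C := lcoef (lambdaL D r) k%:Z.
Definition pco D r (k : nat) : C := lcoef (phiL D r) k%:Z.

(** Indicial polynomial, its roots, and the Frobenius coefficients. *)
Definition indicial (l0 p0 x : C) : C := x * (x - 1) + l0 * x + p0.

(* [Rm] is the smaller index: the indices may be complex, and a positive      *)
(* integer difference is only possible with the order of the real parts.      *)
Definition is_indices (l0 p0 Rp Rm : C) : Prop :=
  (forall x, indicial l0 p0 x = (x - Rp) * (x - Rm)) /\ 'Re Rm <= 'Re Rp.

Definition frobenius (l p : nat -> C) (R : C) : nat -> C :=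
  cov 0 (fun m A =>
    if m is 0 then 1
    else - (indicial (l 0%N) (p 0%N) (R + m%:R))^-1
         * \sum_(1 <= k < m.+1) (l k * (R + (m - k)%:R) + p k) * A (m - k)%N).

Arguments frobenius : simpl never.

Lemma frobeniusE l p R m : frobenius l p R m =
  if m is 0 then 1
  else - (indicial (l 0%N) (p 0%N) (R + m%:R))^-1
       * \sum_(1 <= k < m.+1)
           (l k * (R + (m - k)%:R) + p k) * frobenius l p R (m - k)%N.
Proof.
rewrite /frobenius covE //; case=> // {}m f g eq_fg; congr (_ * _).
apply: eq_big_nat => k /andP[k_gt0 _]; rewrite eq_fg //.
by rewrite ltn_subrL k_gt0.
Qed.

Definition Fpol D r (x : C) : C := indicial (lco D r 0) (pco D r 0) x.

Definition indices D r (Rp Rm : C) : Prop :=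
  is_indices (lco D r 0) (pco D r 0) Rp Rm.

Definition Acoef D r (R : C) : nat -> C := frobenius (lco D r) (pco D r) R.

(* The change of a quantity when order N^nLO becomes available.               *)
Definition delta (n : nat) (Q : pert C -> C) D : C :=
  Q (trunc n.+1 D) - Q (trunc n D).

(* The unknowns of the next order: gamma^[n+1] and beta_n.                    *)
Definition unknowns (n : nat) D : 'M[C]_2 * C^o := (gam D n, bet D n).

End Evolution.

(* Main.v *)
Require Import Defs.
From HB Require Import structures.
From mathcomp Require Import all_boot all_order all_algebra.
From mathcomp Require Import all_classical all_reals all_analysis.
From mathcomp Require Import ring.

Set Implicit Arguments.
Unset Strict Implicit.
Unset Printing Implicit Defensive.

Import Order.TTheory GRing.Theory Num.Theory numFieldNormedType.Exports.
Local Open Scope ring_scope.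

(* With beta = - a^2 B, gamma_(r,other r) = a G, gamma_(other r,r) = a H and      *)
(* gamma_(other r,other r) - gamma_(r,r) = a d one has                            *)
(*   lambda = (2 B + a B' + d) / B - (G + a G') / G,   phi = - G H / B^2,         *)
(* quotients of power series whose denominators do not vanish at a = 0.  The k-th *)
(* coefficient of such a quotient depends on the data up to order k only, and,    *)
(* for k >= 1, affinely on the data of order k itself.  The Frobenius recursion   *)
(* inherits both properties.  For the truncations B, G, H, d are polynomials, and *)
(* the O-estimates follow because the recursions satisfied by l_k and p_k make    *)
(* the first m coefficients of [numerator - denominator * partial sum] vanish.    *)

(** The coefficient [k] of [lambda] or [phi] involves only data of order at most [k] ([lco_local],
    [pco_local]), whence exactness below [n]. For [n >= 1], coefficient [n] of a Cauchy product or
    of a reciprocal is affine in the data of order [n], since two such data meet only at order [2n]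
    ([conv_top], [inv_body_top]); hence [l_n] and [p_n] change by the linear forms [lco_form] and
    [pco_form] ([lco_top], [pco_top]). In the Frobenius recursion for [A_n] only the summand
    [k = n], multiplied by [A_0 = 1], sees [l_n] and [p_n], so [A_n] moves by
    [-(R dl + dp) / F(R + n)] ([frobenius_top]), where [F(R + n)] is nonzero off resonance. Thus
    [A_n] is inexact precisely when the linear form [R dl + dp] is nonzero at the unknowns, and a
    matrix unit shows that this form does not vanish identically. *)

Section Horner.
Variable K : numFieldType.
Implicit Types p q : {poly K}.

Lemma is_derive_horner p (x : K) : is_derive x (1 : K) (horner p) p^`().[x].
Proof.
elim/poly_ind: p => [|p c IHp].
  rewrite deriv0 horner0.
  have -> : horner (0 : {poly K}) = cst 0 by apply/funext => y; rewrite horner0.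
  exact: is_derive_cst.
have -> : horner (p * 'X + c%:P) = horner p * id + cst c.
  by apply/funext => y; rewrite !hornerE.
apply: is_derive_eq.
rewrite derivD derivM derivX derivC !hornerE /GRing.scale /=.
by rewrite mulr1 mulrC addrC.
Qed.

Lemma derive1_horner p (x : K) : derive1 (horner p) x = p^`().[x].
Proof. by rewrite derive1E; have [_ ->] := is_derive_horner p x. Qed.

Lemma continuous_horner_num p : continuous (horner p : K -> K).
Proof.
move=> x; apply/differentiable_continuous/derivable1_diffP.
by have [] := is_derive_horner p x.
Qed.

Lemma near_horner_neq0 p : p`_0 != 0 -> \forall a \near (0 : K)^'%classic, p.[a] != 0.
Proof.
rewrite -horner_coef0 => p0.
apply: (@nbhs_dnbhs K).
have := @continuous_horner_num p 0.
by move/cvgr_neq0 => /(_ p0).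
Qed.

End Horner.

(** * Order estimates for rational functions at 0 *)

Section BigO.
Variable C : numClosedFieldType.
Implicit Types (f g : C -> C) (P Q : {poly C}).

Lemma is_OP n f :
  is_O n f <-> exists2 k, 0 < k & \forall a \near (0 : C)^'%classic, `|f a| <= k * `|a ^+ n|.
Proof. exact: eqO_exP. Qed.

Lemma is_OD n f g : is_O n f -> is_O n g -> is_O n (fun a => f a + g a).
Proof.
move=> /is_OP[k k0 fk] /is_OP[l l0 gl]; apply/is_OP.
exists (k + l); first exact: addr_gt0.
near=> a; rewrite mulrDl (le_trans (ler_normD _ _)) // lerD //.
  by near: a.
by near: a.
Unshelve. all: by end_near. Qed.

Lemma is_ON n f : is_O n f -> is_O n (fun a => - f a).
Proof.
move=> /is_OP[k k0 fk]; apply/is_OP; exists k => //.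
by near=> a; rewrite normrN; near: a.
Unshelve. all: by end_near. Qed.

(** The [l k] are the Taylor coefficients of [P / Q], so [P - Q * S], with [S] the partial sum, is
    divisible by ['X^m]; the remainder is [a^m] times [T / Q], which is continuous at 0 and hence
    bounded near it. *)
Lemma is_O_ratio (h : C -> C) P Q (l : nat -> C) m :
    Q`_0 != 0 ->
    (\forall a \near (0 : C)^'%classic, h a = P.[a] / Q.[a]) ->
    (forall k, \sum_(i < k.+1) Q`_i * l (k - i)%N = P`_k) ->
  is_O m (fun a => h a - \sum_(k < m) l k * a ^+ k).
Proof.
move=> Q0 hPQ Ql; pose S := \poly_(k < m) l k.
pose T := drop_poly m (P - Q * S).
have remE : P - Q * S = T * 'X^m.
  rewrite -[LHS](poly_take_drop m); apply/eqP; rewrite -subr_eq0 addrK; apply/eqP/polyP => k.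
  rewrite coef0 coef_take_poly; case: ifP => // lt_km.
  rewrite coefB coefM -Ql; apply/eqP; rewrite subr_eq0; apply/eqP.
  apply: eq_bigr => i _; rewrite coef_poly.
  by rewrite (leq_ltn_trans (leq_subr _ _) lt_km).
have Tbnd : \forall a \near (0 : C)^'%classic, `|T.[a] / Q.[a]| < `|T.[0] / Q.[0]| + 1.
  apply: (@nbhs_dnbhs C).
  have TQ : ((fun a => T.[a] / Q.[a]) @ (0 : C) --> T.[0] / Q.[0])%classic.
    have Q00 : Q.[0] != 0 by rewrite horner_coef0.
    exact: cvgM (@continuous_horner_num C T 0)
                (cvgV Q00 (@continuous_horner_num C Q 0)).
  by move/cvgr_norm_lt: TQ; apply; rewrite ltrDl ltr01.
apply/is_OP; exists (`|T.[0] / Q.[0]| + 1).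
  by rewrite ltr_wpDl.
have Qn0 := near_horner_neq0 Q0.
near=> a.
have -> : h a - \sum_(k < m) l k * a ^+ k = T.[a] / Q.[a] * a ^+ m.
  have Qa : Q.[a] != 0 by near: a.
  have -> : h a = P.[a] / Q.[a] by near: a.
  have <- : S.[a] = \sum_(k < m) l k * a ^+ k by rewrite horner_poly.
  have := congr1 (horner^~ a) remE.
  rewrite !hornerE => /(canRL (subrK _)) ->.
  by field.
rewrite normrM ler_wpM2r // ltW //; near: a; exact: Tbnd.
Unshelve. all: by end_near. Qed.

End BigO.

(** * Cauchy products and reciprocals of coefficient sequences *)

Section Convolution.
Variable K : fieldType.
Implicit Types (f g h b : nat -> K) (p q : {poly K}).

Definition conv f g (k : nat) : K := \sum_(i < k.+1) f i * g (k - i)%N.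

Definition conv1 (k : nat) : K := (k == 0%N)%:R.

Lemma coef_conv p q : (fun k => (p * q)`_k) = conv (fun k => p`_k) (fun k => q`_k).
Proof. by apply/funext => k; rewrite coefM. Qed.

Lemma eq_conv f f' g g' k :
  (forall i, (i <= k)%N -> f i = f' i) -> (forall i, (i <= k)%N -> g i = g' i) ->
  conv f g k = conv f' g' k.
Proof.
move=> ff' gg'; apply: eq_bigr => i _.
by rewrite ff' -1?ltnS // gg' // leq_subr.
Qed.

(* Both sides only involve finitely many coefficients, which reduces the ring *)
(* laws to those of polynomials.                                              *)
Lemma conv_poly N f g k : (k < N)%N ->
  conv f g k = (\poly_(i < N) f i * \poly_(i < N) g i)`_k.
Proof.
move=> lt_kN; rewrite coefM; apply: eq_bigr => i _; rewrite !coef_poly.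
have -> : (i < N)%N by rewrite (leq_trans (ltn_ord i)).
by rewrite (leq_ltn_trans (leq_subr _ _) lt_kN).
Qed.

Lemma convC f g : conv f g = conv g f.
Proof. by apply/funext => k; rewrite !(@conv_poly k.+1) // mulrC. Qed.

Lemma convA f g h : conv f (conv g h) = conv (conv f g) h.
Proof.
have convE (u v w : nat -> K) k : conv (conv u v) w k =
    (\poly_(i < k.+1) u i * \poly_(i < k.+1) v i * \poly_(i < k.+1) w i)`_k.
  rewrite coefM; apply: eq_bigr => i _; rewrite (@conv_poly k.+1) //.
  by rewrite [X in _ = _ * X]coef_poly ltnS leq_subr.
apply/funext => k; rewrite convC !convE [_ * \poly_(i < k.+1) f i]mulrC.
by rewrite mulrA.
Qed.

Lemma convCA f g h : conv f (conv g h) = conv g (conv f h).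
Proof. by rewrite !convA (convC f). Qed.

Lemma convDr f g h k : conv f (fun i => g i + h i) k = conv f g k + conv f h k.
Proof. by rewrite /conv -big_split; apply: eq_bigr => i _; rewrite mulrDr. Qed.

Lemma convNr f g k : conv f (fun i => - g i) k = - conv f g k.
Proof. by rewrite /conv -sumrN; apply: eq_bigr => i _; rewrite mulrN. Qed.

Lemma conv1l f : conv conv1 f = f.
Proof.
apply/funext => k; rewrite /conv big_ord_recl /conv1 /= mul1r subn0 big1 ?addr0 //.
by move=> i _; rewrite mul0r.
Qed.

Lemma conv_inv b : b 0%N != 0 -> conv b (inv_body b) = conv1.
Proof.
move=> b0; apply/funext => k.
have := @lmul_linv _ (Laurent 0 b) k%:Z b0.
by rewrite /lcoef /= addn0.
Qed.

Lemma conv0 f g : conv f g 0 = f 0%N * g 0%N.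
Proof. by rewrite /conv big_ord_recl big_ord0 addr0. Qed.

Lemma inv_body0 b : inv_body b 0 = (b 0%N)^-1.
Proof. by rewrite inv_bodyE. Qed.

Lemma eq_inv_body b b' k :
  (forall i, (i <= k)%N -> b i = b' i) -> inv_body b k = inv_body b' k.
Proof.
elim/ltn_ind: k => -[|k] IHk bb'; rewrite !inv_bodyE bb' //.
congr (_ * _); apply: eq_big_nat => i /andP[i_gt0 le_ik]; rewrite bb' //.
rewrite IHk // ?ltn_subrL ?i_gt0 // => j le_j; apply: bb'.
exact: leq_trans le_j (leq_subr _ _).
Qed.

(** Only the two extreme summands contain a term of index [n]; [0 < n] makes them distinct, and the
    coefficients of index 0 are then common. *)
Lemma conv_top n f f' g g' : (0 < n)%N ->
    (forall i, (i < n)%N -> f i = f' i) -> (forall i, (i < n)%N -> g i = g' i) ->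
  conv f' g' n - conv f g n = (f' n - f n) * g 0%N + f 0%N * (g' n - g n).
Proof.
case: n => // n _ ff' gg'; rewrite /conv.
rewrite !(big_ord_recl n.+1) !(big_ord_recr n) /= !subn0.
rewrite /bump /= add1n subnn -(ff' 0%N) // -(gg' 0%N) //.
have -> : \sum_(i < n) f' (1 + i)%N * g' (n.+1 - (1 + i))%N
        = \sum_(i < n) f (1 + i)%N * g (n.+1 - (1 + i))%N.
  by apply: eq_bigr => i _; rewrite add1n subSS ff' ?gg' ?ltnS ?leq_subr.
ring.
Qed.

(** In the recursion for the reciprocal, [b n] occurs only in the last summand, against the
    coefficient [1 / b 0]. *)
Lemma inv_body_top n b b' : (0 < n)%N -> b 0%N != 0 ->
    (forall i, (i < n)%N -> b i = b' i) ->
  inv_body b' n - inv_body b n = - (b' n - b n) / b 0%N ^+ 2.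
Proof.
case: n => // n _ b0 bb'; rewrite !(inv_bodyE _ n.+1) !(big_nat_recr n.+1) //=.
rewrite subnn !inv_body0 -bb' //.
have -> : \sum_(1 <= i < n.+1) b' i * inv_body b' (n.+1 - i)%N
        = \sum_(1 <= i < n.+1) b i * inv_body b (n.+1 - i)%N.
  apply: eq_big_nat => i /andP[i_gt0 lt_in]; rewrite bb' //; congr (_ * _).
  apply: eq_inv_body => j le_j; rewrite bb' //.
  by rewrite (leq_ltn_trans le_j) // ltn_subrL i_gt0.
by field.
Qed.

End Convolution.

(** * The coefficients [l_k] and [p_k]: closed forms, locality, first variation *)

Section Coefficients.
Variable C : numClosedFieldType.
Implicit Types (D E : pert C) (r : 'I_2).

(** Beta is [a^2] times this series, the opposite of the sign convention in the overview, so [dgam]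
    enters [lambda] with a minus sign. *)
Definition nbet D (k : nat) : C := - bet D k.
Definition gams D (i j : 'I_2) (k : nat) : C := gam D k i j.
Definition dgam D r (k : nat) : C := gams D (other r) (other r) k - gams D r r k.

Lemma lcoef_lbody (f : laurent C) (k : nat) : lcoef f (Defs.lshift f + k%:Z) = lbody f k.
Proof. by rewrite /lcoef lerDl addrAC subrr add0r. Qed.

Lemma lbody_lmul (f g : laurent C) : lbody (lmul f g) = conv (lbody f) (lbody g).
Proof. by []. Qed.

Lemma lbody_ladd (f g : laurent C) v k : Defs.lshift f = v -> Defs.lshift g = v ->
  lbody (ladd f g) k = lbody f k + lbody g k.
Proof.
move=> fv gv; rewrite /= fv gv minxx.
by rewrite -{1}fv -gv !lcoef_lbody.
Qed.

Definition lambda_num D r (k : nat) : C :=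
  (2%:R + k%:R) * nbet D k -
  (dgam D r k
   + conv (conv (nbet D) (fun i => (1 + i%:R) * gams D r (other r) i))
          (inv_body (gams D r (other r))) k).

(** The shifts 1, 1 and -2 of [lvar], of the numerator and of [1 / beta] add up to 0, so
    coefficients can be read off the body. *)
Lemma lcoE D r : lco D r = conv (lambda_num D r) (inv_body (nbet D)).
Proof.
apply/funext => k; rewrite /lco (lcoef_lbody (lambdaL D r)).
rewrite !lbody_lmul -[lbody (lvar C)]/(conv1 C) conv1l.
apply: eq_conv => // i _.
rewrite (@lbody_ladd _ _ 1) //.
rewrite -[lbody (lopp _) i]/(- lbody (LambdaL D r) i).
rewrite (@lbody_ladd _ _ 1) //.
rewrite (@lbody_ladd _ _ 1) //.
rewrite !lbody_lmul /lambda_num /= intrD.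
congr (_ - (_ + conv (conv _ _) _ _)).
by apply/funext => j; rewrite intrD.
Qed.

Lemma pcoE D r : pco D r =
  fun k => - conv (conv (gams D r (other r)) (gams D (other r) r))
                  (inv_body (conv (nbet D) (nbet D))) k.
Proof.
apply/funext => k; rewrite /pco (lcoef_lbody (phiL D r)).
rewrite lbody_lmul convC convNr [lbody (lmul (lvar _) _)]lbody_lmul.
by rewrite convC -[lbody (lvar C)]/(conv1 C) !conv1l.
Qed.

(** The closed form with denominators cleared, as [is_O_ratio] requires for the truncated data. *)
Lemma lco_recurrence D r : bet D 0%N != 0 -> gam D 0%N r (other r) != 0 ->
  conv (conv (nbet D) (gams D r (other r))) (lco D r) = fun k =>
  conv (gams D r (other r)) (fun i => (2%:R + i%:R) * nbet D i - dgam D r i) k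
  - conv (nbet D) (fun i => (1 + i%:R) * gams D r (other r) i) k.
Proof.
move=> b0 g0; have nb0 : nbet D 0 != 0 by rewrite oppr_eq0.
rewrite lcoE (convC (lambda_num _ _)) (convC (nbet D)) -convA.
rewrite (convA (nbet D)) conv_inv // conv1l.
have -> : lambda_num D r = fun k => (2%:R + k%:R) * nbet D k - dgam D r k
    + - conv (conv (nbet D) (fun i => (1 + i%:R) * gams D r (other r) i))
          (inv_body (gams D r (other r))) k.
  by apply/funext => k; rewrite /lambda_num opprD addrA.
apply/funext => k; rewrite convDr convNr convCA conv_inv //.
by rewrite [conv _ (conv1 C)]convC conv1l.
Qed.

Lemma pco_recurrence D r : bet D 0%N != 0 ->
  conv (conv (nbet D) (nbet D)) (pco D r) =
  fun k => - conv (gams D r (other r)) (gams D (other r) r) k.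
Proof.
move=> b0; apply/funext => k; rewrite pcoE convNr convCA conv_inv.
  by rewrite [conv _ (conv1 C)]convC conv1l.
by rewrite conv0 mulf_neq0 // oppr_eq0.
Qed.

(** A relation between arbitrary data, so that truncations, completions and perturbations are
    handled alike. *)
Definition agree n D E :=
  forall i, (i < n)%N -> gam D i = gam E i /\ bet D i = bet E i.

Lemma agree_nbet n D E i : agree n D E -> (i < n)%N -> nbet D i = nbet E i.
Proof. by move=> DE /DE[_]; rewrite /nbet => ->. Qed.

Lemma agree_gams n D E a b i : agree n D E -> (i < n)%N -> gams D a b i = gams E a b i.
Proof. by move=> DE /DE[]; rewrite /gams => ->. Qed.

Lemma lco_local k D E r : agree k.+1 D E -> lco D r k = lco E r k.
Proof.
move=> DE; rewrite !lcoE.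
have nbE i (le_ik : (i <= k)%N) := agree_nbet DE le_ik.
have ggE a b i (le_ik : (i <= k)%N) := agree_gams a b DE le_ik.
apply: eq_conv => i le_ik; last first.
  by apply: eq_inv_body => j le_ji; rewrite nbE // (leq_trans le_ji).
rewrite /lambda_num /dgam nbE // !ggE //; congr (_ - (_ + _)).
apply: eq_conv => j le_ji; have le_jk := leq_trans le_ji le_ik.
  by apply: eq_conv => l le_lj; rewrite ?nbE ?ggE // (leq_trans le_lj).
by apply: eq_inv_body => l le_lj; rewrite ggE // (leq_trans le_lj).
Qed.

Lemma pco_local k D E r : agree k.+1 D E -> pco D r k = pco E r k.
Proof.
move=> DE; rewrite !pcoE.
have nbE i (le_ik : (i <= k)%N) := agree_nbet DE le_ik.
have ggE a b i (le_ik : (i <= k)%N) := agree_gams a b DE le_ik.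
congr (- _); apply: eq_conv => i le_ik.
  by apply: eq_conv => j le_ji; rewrite ggE // (leq_trans le_ji).
apply: eq_inv_body => j le_ji; have le_jk := leq_trans le_ji le_ik.
by apply: eq_conv => l le_lj; rewrite nbE // (leq_trans le_lj).
Qed.

(* The coefficients of order 0 of [D] are those of every truncation [trunc n D] *)
(* with [0 < n], so that the two forms below are determined by the truncation.  *)
Definition lco_form D n r (X : 'M[C]_2 * C^o) : C^o :=
  n%:R * X.2 / bet D 0 + (X.1 (other r) (other r) - X.1 r r) / bet D 0
  - dgam D r 0 * X.2 / bet D 0 ^+ 2 - n%:R * X.1 r (other r) / gam D 0 r (other r).

Definition pco_form D r (X : 'M[C]_2 * C^o) : C^o :=
  2%:R * gam D 0 r (other r) * gam D 0 (other r) r * X.2 / bet D 0 ^+ 3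
  - (X.1 r (other r) * gam D 0 (other r) r
     + gam D 0 r (other r) * X.1 (other r) r) / bet D 0 ^+ 2.

Lemma lco_form_linear D n r : linear (lco_form D n r).
Proof.
move=> a X Y; rewrite /lco_form /= !mxE /GRing.scale /=; ring.
Qed.

Lemma pco_form_linear D r : linear (pco_form D r).
Proof.
move=> a X Y; rewrite /pco_form /= !mxE /GRing.scale /=; ring.
Qed.

HB.instance Definition _ D n r :=
  GRing.isLinear.Build C _ C^o _ (lco_form D n r) (@lco_form_linear D n r).

HB.instance Definition _ D r :=
  GRing.isLinear.Build C _ C^o _ (pco_form D r) (@pco_form_linear D r).

Lemma lco_top n D E r : (0 < n)%N -> bet D 0%N != 0 -> gam D 0%N r (other r) != 0 ->
  agree n D E ->
  lco E r n - lco D r n = lco_form D n r (gam E n - gam D n, bet E n - bet D n).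
Proof.
move=> n0 b0 g0 DE; have nb0 : nbet D 0 != 0 by rewrite oppr_eq0.
have nbE i := @agree_nbet _ _ _ i DE; have ggE a b i := @agree_gams _ _ _ a b i DE.
have lnE i : (i < n)%N -> lambda_num D r i = lambda_num E r i.
  move=> lt_in; rewrite /lambda_num /dgam nbE // !ggE //; congr (_ - (_ + _)).
  apply: eq_conv => j le_ji; have lt_jn := leq_ltn_trans le_ji lt_in.
    by apply: eq_conv => l le_lj; rewrite ?nbE ?ggE // (leq_ltn_trans le_lj).
  by apply: eq_inv_body => l le_lj; rewrite ggE // (leq_ltn_trans le_lj).
rewrite !lcoE (conv_top n0 lnE); last first.
  by move=> i lt_in; apply: eq_inv_body => j le_ji; rewrite nbE // (leq_ltn_trans le_ji).
rewrite (inv_body_top n0 nb0 nbE) inv_body0.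
(* [W] is the numerator of the quotient in [Lambda]; [WE] and [VE] are the product and quotient
   rules for its variation. *)
pose W F := conv (nbet F) (fun i => (1 + i%:R) * gams F r (other r) i).
have WE : W E n - W D n = (nbet E n - nbet D n) * gams D r (other r) 0
    + nbet D 0 * ((1 + n%:R) * (gams E r (other r) n - gams D r (other r) n)).
  rewrite (conv_top n0 nbE); last by move=> i lt_in; rewrite ggE.
  by rewrite addr0; ring.
have VE : conv (W E) (inv_body (gams E r (other r))) n
        - conv (W D) (inv_body (gams D r (other r))) n =
    (W E n - W D n) / gams D r (other r) 0
    - W D 0%N * (gams E r (other r) n - gams D r (other r) n) / gams D r (other r) 0 ^+ 2.
  rewrite (conv_top n0).
  - by rewrite inv_body0 (inv_body_top n0 g0 (ggE _ _)); field.
  - move=> i lt_in; apply: eq_conv => j le_ji;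
      by rewrite ?nbE ?ggE // (leq_ltn_trans le_ji).
  - by move=> i lt_in; apply: eq_inv_body => j le_ji; rewrite ggE // (leq_ltn_trans le_ji).
have -> : lambda_num E r n - lambda_num D r n =
   (2%:R + n%:R) * (nbet E n - nbet D n) - (dgam E r n - dgam D r n)
   - ((W E n - W D n) / gams D r (other r) 0
    - W D 0%N * (gams E r (other r) n - gams D r (other r) n) / gams D r (other r) 0 ^+ 2).
  by rewrite -VE /lambda_num /W; ring.
rewrite WE /lambda_num /W !conv0 inv_body0 /lco_form /= !mxE /dgam /gams /nbet.
by field; rewrite b0 g0.
Qed.

Lemma pco_top n D E r : (0 < n)%N -> bet D 0%N != 0 -> agree n D E ->
  pco E r n - pco D r n = pco_form D r (gam E n - gam D n, bet E n - bet D n).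
Proof.
move=> n0 b0 DE.
have nbE i := @agree_nbet _ _ _ i DE; have ggE a b i := @agree_gams _ _ _ a b i DE.
have bbE i : (i < n)%N -> conv (nbet D) (nbet D) i = conv (nbet E) (nbet E) i.
  by move=> lt_in; apply: eq_conv => j le_ji; rewrite nbE // (leq_ltn_trans le_ji).
have bb0 : conv (nbet D) (nbet D) 0 != 0 by rewrite conv0 mulf_neq0 // oppr_eq0.
rewrite !pcoE -opprD (conv_top n0).
- rewrite (inv_body_top n0 bb0 bbE) inv_body0 (conv_top n0 nbE nbE).
  rewrite (conv_top n0 (ggE _ _) (ggE _ _)) !conv0 /pco_form /= !mxE /gams /nbet.
  by field.
- move=> i lt_in; apply: eq_conv => j le_ji;
    by rewrite ggE // (leq_ltn_trans le_ji).
- move=> i lt_in; apply: eq_inv_body => j le_ji.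
  by rewrite bbE // (leq_ltn_trans le_ji).
Qed.

End Coefficients.

(** * Asymptotic expansions of the truncated coefficient functions *)

Section Expansion.
Variable C : numClosedFieldType.
Implicit Types (D E : pert C) (r : 'I_2).

Definition gamP n D (i j : 'I_2) : {poly C} := \poly_(k < n) gam D k i j.
Definition nbetP n D : {poly C} := \poly_(k < n) - bet D k.

Lemma gams_trunc n D i j : gams (trunc n D) i j = fun k => (gamP n D i j)`_k.
Proof.
by apply/funext => k; rewrite coef_poly /gams /=; case: ifP; rewrite ?mxE.
Qed.

Lemma nbet_trunc n D : nbet (trunc n D) = fun k => (nbetP n D)`_k.
Proof.
by apply/funext => k; rewrite coef_poly /nbet /=; case: ifP; rewrite ?oppr0.
Qed.

Lemma gamF_horner n D i j : gamF n D i j = horner ('X * gamP n D i j).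
Proof.
apply/funext => a; rewrite hornerM hornerX horner_poly mulr_sumr.
by apply: eq_bigr => k _; rewrite exprS; ring.
Qed.

Lemma betF_horner n D : betF n D = horner ('X^2 * nbetP n D).
Proof.
apply/funext => a; rewrite /betF hornerM hornerXn horner_poly mulr_sumr -sumrN.
by apply: eq_bigr => k _; rewrite !exprS; ring.
Qed.

Section NonDegenerate.
Variables (n : nat) (D : pert C) (r : 'I_2).
Hypotheses (n_gt0 : (0 < n)%N) (b0 : bet D 0 != 0) (g0 : gam D 0 r (other r) != 0).

Let B := nbetP n D.
Let G := gamP n D r (other r).
Let H := gamP n D (other r) r.
Let d := gamP n D (other r) (other r) - gamP n D r r.

Lemma nbetP0 : B`_0 != 0.
Proof. by rewrite coef_poly n_gt0 oppr_eq0. Qed.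

Lemma gamP0 : G`_0 != 0.
Proof. by rewrite coef_poly n_gt0. Qed.

(** The powers of [a] cancel once [a], [B] and [G] are nonzero, hence the punctured
    neighbourhood. *)
Lemma lambdaF_ratio : \forall a \near (0 : C)^'%classic, lambdaF n D r a =
  ((2%:R *: B + 'X * B^`() - d) * G - B * (G + 'X * G^`())).[a] / (B * G).[a].
Proof.
have Bn0 := near_horner_neq0 nbetP0; have Gn0 := near_horner_neq0 gamP0.
near=> a.
have a0 : a != 0 by near: a; exact: nbhs_dnbhs_neq.
have Ba : B.[a] != 0 by near: a.
have Ga : G.[a] != 0 by near: a.
rewrite /lambdaF /LambdaF betF_horner !gamF_horner !derive1_horner.
rewrite !derivM !derivX -/B -/G.
rewrite /d !(hornerE, hornerMn) /=.
by field; rewrite a0 Ba Ga.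
Unshelve. all: by end_near. Qed.

Lemma phiF_ratio : \forall a \near (0 : C)^'%classic, phiF n D r a =
  (- (G * H)).[a] / (B * B).[a].
Proof.
have Bn0 := near_horner_neq0 nbetP0.
near=> a.
have a0 : a != 0 by near: a; exact: nbhs_dnbhs_neq.
have Ba : B.[a] != 0 by near: a.
rewrite /phiF betF_horner !gamF_horner -/B -/G -/H !(hornerN, hornerM, hornerX, hornerXn).
by field; rewrite a0 Ba.
Unshelve. all: by end_near. Qed.

Let bt0 : bet (trunc n D) 0 != 0. Proof. by rewrite /= n_gt0. Qed.
Let gt0 : gam (trunc n D) 0 r (other r) != 0. Proof. by rewrite /= n_gt0. Qed.

Lemma lambdaF_expansion m :
  is_O m (fun a => lambdaF n D r a - \sum_(k < m) lco (trunc n D) r k * a ^+ k).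
Proof.
apply: is_O_ratio lambdaF_ratio _; first by rewrite coef0M mulf_neq0 ?nbetP0 ?gamP0.
move=> k; have /(congr1 (@^~ k)) := lco_recurrence bt0 gt0.
rewrite !gams_trunc nbet_trunc -coef_conv -/B -/G.
rewrite -[conv _ (lco _ _) k]/(\sum_(i < k.+1) _) => ->.
(* The weight [1 + i] is the derivative of ['X * p]; the weight [2 + i] below is one more copy of
   [p]. *)
have shiftE (p : {poly C}) : (fun i => (1 + i%:R) * p`_i) = fun i => (p + 'X * p^`())`_i.
  apply/funext => -[|i]; rewrite coefD coefXM /= ?coef_deriv; first by ring.
  by rewrite mulrDl mul1r mulr_natl.
have -> : (fun i => (2%:R + i%:R) * B`_i - dgam (trunc n D) r i)
        = fun i => (2%:R *: B + 'X * B^`() - d)`_i.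
  apply/funext => i; have := congr1 (@^~ i) (shiftE B).
  rewrite /dgam !gams_trunc /d !coefD !coefN coefZ => /= E.
  have -> : (2%:R + i%:R) * B`_i = B`_i + (1 + i%:R) * B`_i by ring.
  by rewrite E coefB; ring.
by rewrite shiftE -!coef_conv coefB [_ * G]mulrC.
Qed.

Lemma phiF_expansion m :
  is_O m (fun a => phiF n D r a - \sum_(k < m) pco (trunc n D) r k * a ^+ k).
Proof.
apply: is_O_ratio phiF_ratio _; first by rewrite coef0M mulf_neq0 ?nbetP0.
move=> k; have /(congr1 (@^~ k)) := pco_recurrence r bt0.
rewrite !gams_trunc nbet_trunc -coef_conv -/B -/G -/H.
rewrite -[conv _ (pco _ _) k]/(\sum_(i < k.+1) _) => ->.
by rewrite -coef_conv coefN.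
Qed.

End NonDegenerate.
End Expansion.

(** * Frobenius coefficients and the indicial polynomial *)

Section Frobenius.
Variable C : numClosedFieldType.
Implicit Types (l p : nat -> C).

Lemma frobenius_local l l' p p' (R : C) m :
  (forall i, (i <= m)%N -> l i = l' i /\ p i = p' i) ->
  frobenius l p R m = frobenius l' p' R m.
Proof.
elim/ltn_ind: m => -[|m] IHm lp; rewrite !frobeniusE //.
have [-> ->] := lp 0%N isT.
congr (_ * _); apply: eq_big_nat => i /andP[i_gt0 le_im].
have [-> ->] := lp i le_im.
rewrite (IHm (m.+1 - i)%N) ?ltn_subrL ?i_gt0 // => j le_j.
by apply: lp; rewrite (leq_trans le_j) // leq_subr.
Qed.

(** In the summand [k = n] the shift [n - k] is 0, which leaves [R * l n + p n]; the denominator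
    uses only index 0, common to both sides. *)
Lemma frobenius_top l l' p p' (R : C) n : (0 < n)%N ->
    (forall i, (i < n)%N -> l i = l' i /\ p i = p' i) ->
  frobenius l' p' R n - frobenius l p R n =
  - ((R * (l' n - l n) + (p' n - p n)) / indicial (l 0%N) (p 0%N) (R + n%:R)).
Proof.
case: n => // n _ lp; rewrite !(frobeniusE _ _ _ n.+1) !(big_nat_recr n.+1) //=.
rewrite subnn addr0 !(frobeniusE _ _ _ 0).
have [<- <-] := lp 0%N isT.
have -> : \sum_(1 <= k < n.+1) (l' k * (R + (n.+1 - k)%:R) + p' k)
                                * frobenius l' p' R (n.+1 - k)%N
        = \sum_(1 <= k < n.+1) (l k * (R + (n.+1 - k)%:R) + p k)
                                * frobenius l p R (n.+1 - k)%N.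
  apply: eq_big_nat => i /andP[i_gt0 lt_in]; have [-> ->] := lp i lt_in.
  congr (_ * _); apply/esym/frobenius_local => j le_j; apply: lp.
  by rewrite (leq_ltn_trans le_j) // ltn_subrL i_gt0.
ring.
Qed.

Lemma indicial_Rp (l0 p0 Rp Rm : C) n : is_indices l0 p0 Rp Rm ->
  indicial l0 p0 (Rp + n%:R) = n%:R * (n%:R + (Rp - Rm)).
Proof. by move=> [-> _]; ring. Qed.

Lemma indicial_Rm (l0 p0 Rp Rm : C) n : is_indices l0 p0 Rp Rm ->
  indicial l0 p0 (Rm + n%:R) = n%:R * (n%:R - (Rp - Rm)).
Proof. by move=> [-> _]; ring. Qed.

(** At [Rp] the factor [n + (Rp - Rm)] has positive real part by the ordering of the indices; at
    [Rm] nonresonance is what excludes a zero. *)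
Lemma indicial_shift_neq0 (l0 p0 Rp Rm R : C) n : (0 < n)%N ->
    is_indices l0 p0 Rp Rm -> Rp - Rm <> n%:R -> R = Rp \/ R = Rm ->
  indicial l0 p0 (R + n%:R) != 0.
Proof.
move=> n0 ind nonres [->|->].
  rewrite (indicial_Rp _ ind) mulf_neq0 ?pnatr_eq0 -?lt0n //.
  apply/eqP => /(congr1 (fun z => 'Re z)); rewrite raddfD raddfB /= raddf0.
  rewrite (Creal_ReP _ _) ?realn //.
  case: ind => _ le_Re; apply/eqP; rewrite gt_eqF // ltr_pwDl ?ltr0n //.
  by rewrite subr_ge0.
rewrite (indicial_Rm _ ind) mulf_neq0 ?pnatr_eq0 -?lt0n //.
by rewrite subr_eq0; apply/eqP => /esym.
Qed.

End Frobenius.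

(** * Passing to the next order, and witnesses of what a truncation leaves open *)

Section Truncation.
Variable C : numClosedFieldType.
Implicit Types (D E : pert C) (r : 'I_2).

Lemma agree_truncl n D : agree n (trunc n D) D.
Proof. by move=> i /= ->. Qed.

Lemma trunc_truncS n D : trunc n (trunc n.+1 D) = trunc n D.
Proof.
by congr Pert; apply/funext => i /=; case: ifP => // lt_in; rewrite ltnS ltnW.
Qed.

Lemma unknowns_truncS n D : unknowns n (trunc n.+1 D) = unknowns n D.
Proof. by rewrite /unknowns /= ltnSn. Qed.

Section NextOrder.
Variables (n : nat) (D : pert C) (r : 'I_2).
Hypotheses (n_gt0 : (0 < n)%N) (b0 : bet D 0 != 0) (g0 : gam D 0 r (other r) != 0).

(** [E] is any completion of the truncation, be it the exact data or the next truncation. The data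
    of order [n] in [trunc n D] are 0, so the variation is the unknowns themselves. *)
Lemma lco_next E : trunc n E = trunc n D ->
  lco E r n - lco (trunc n D) r n = lco_form D n r (unknowns n E).
Proof.
move=> ED; have bt0 : bet (trunc n D) 0 != 0 by rewrite /= n_gt0.
have gt0 : gam (trunc n D) 0 r (other r) != 0 by rewrite /= n_gt0.
have DE : agree n (trunc n D) E by rewrite -ED; exact: agree_truncl.
rewrite (lco_top n_gt0 bt0 gt0 DE) /= ltnn !subr0.
by rewrite /lco_form /dgam /gams /= n_gt0.
Qed.

Lemma pco_next E : trunc n E = trunc n D ->
  pco E r n - pco (trunc n D) r n = pco_form D r (unknowns n E).
Proof.
move=> ED; have bt0 : bet (trunc n D) 0 != 0 by rewrite /= n_gt0.
have DE : agree n (trunc n D) E by rewrite -ED; exact: agree_truncl.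
rewrite (pco_top r n_gt0 bt0 DE) /= ltnn !subr0.
by rewrite /pco_form /= n_gt0.
Qed.

Lemma lco_delta E : trunc n E = trunc n D ->
  delta n (fun F => lco F r n) E = lco_form D n r (unknowns n E).
Proof.
by move=> ED; rewrite /delta ED lco_next ?unknowns_truncS // trunc_truncS.
Qed.

Lemma pco_delta E : trunc n E = trunc n D ->
  delta n (fun F => pco F r n) E = pco_form D r (unknowns n E).
Proof.
by move=> ED; rewrite /delta ED pco_next ?unknowns_truncS // trunc_truncS.
Qed.

End NextOrder.

(** For [n <= k] the change is invisible to the truncation [n], which yields the competing data for
    [l_k] and [p_k]. *)
Definition perturb k (X : 'M[C]_2) D : pert C :=
  Pert (fun i => if i == k then gam D i + X else gam D i) (bet D).

Lemma trunc_perturb n k X D : (n <= k)%N -> trunc n (perturb k X D) = trunc n D.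
Proof.
move=> le_nk; congr Pert; apply/funext => i /=; case: ifP => // lt_in.
by rewrite ltn_eqF // (leq_trans lt_in).
Qed.

Lemma other_neq r : (other r == r) = false.
Proof. by apply/negbTE; case: r => -[|[|//]] lt_r; rewrite -val_eqE. Qed.

Lemma agree_perturb k X D : agree k D (perturb k X D).
Proof. by move=> i lt_ik; rewrite /= ltn_eqF. Qed.

Lemma lco_perturb k X D r : (0 < k)%N -> bet D 0 != 0 -> gam D 0 r (other r) != 0 ->
  lco (perturb k X D) r k - lco D r k = lco_form D k r (X, 0).
Proof.
move=> k0 b0 g0; rewrite (lco_top k0 b0 g0 (@agree_perturb k X D)) /= eqxx.
by rewrite subrr [_ + X]addrC addrK.
Qed.

Lemma pco_perturb k X D r : (0 < k)%N -> bet D 0 != 0 ->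
  pco (perturb k X D) r k - pco D r k = pco_form D r (X, 0).
Proof.
move=> k0 b0; rewrite (pco_top r k0 b0 (@agree_perturb k X D)) /= eqxx.
by rewrite subrr [_ + X]addrC addrK.
Qed.

Lemma lco_form_diag D n r :
  lco_form D n r (delta_mx (other r) (other r), 0) = (bet D 0)^-1.
Proof.
rewrite /lco_form /= !mxE !eqxx [r == _]eq_sym other_neq /=.
by rewrite !(mulr0, mul0r, subr0, add0r) mul1r.
Qed.

(** The entry [(other r, r)] enters [phi] but not [lambda]; with [pco_form_offdiag] it makes
    [R dl + dp] nonzero whatever [R] is. *)
Lemma lco_form_offdiag D n r : lco_form D n r (delta_mx (other r) r, 0) = 0.
Proof.
rewrite /lco_form /= !mxE !eqxx [r == _]eq_sym other_neq /=.
by rewrite !(mulr0, mul0r, subr0, add0r, oppr0).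
Qed.

Lemma pco_form_offdiag D r :
  pco_form D r (delta_mx (other r) r, 0) = - (gam D 0 r (other r) / bet D 0 ^+ 2).
Proof.
rewrite /pco_form /= !mxE !eqxx [r == _]eq_sym other_neq /=.
by rewrite !(mulr0, mul0r, add0r, mulr1).
Qed.

End Truncation.

(** * Assembly of the statement *)

Theorem mainTheorem7 (C : numClosedFieldType) (D : pert C) (r : 'I_2) (n : nat)
    (beta0_gt0 : 0 < bet D 0)
    (gamma1_offdiag : forall i : 'I_2, gam D 0 i (other i) != 0)
    (n_ge1 : (1 <= n)%N) :
  (* lambda_(n), phi_(n) have the expansions sum l_k a^k, sum p_k a^k *)
  (forall m : nat,
     is_O m (fun a => lambdaF n D r a
                      - \sum_(k < m) lco (trunc n D) r k * a ^+ k) /\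
     is_O m (fun a => phiF n D r a
                      - \sum_(k < m) pco (trunc n D) r k * a ^+ k)) /\
  (* lambda_(n+1) - lambda_(n) = O(a^n), phi_(n+1) - phi_(n) = O(a^n) *)
  is_O n (fun a => lambdaF n.+1 D r a - lambdaF n D r a) /\
  is_O n (fun a => phiF n.+1 D r a - phiF n D r a) /\
  (* l_k, p_k are exact for k < n *)
  (forall k : nat, (k < n)%N ->
     lco (trunc n D) r k = lco D r k /\ pco (trunc n D) r k = pco D r k) /\
  (* l_k, p_k with k >= n are not determined by the truncation (n) *)
  (forall k : nat, (n <= k)%N ->
     (exists D' : pert C, trunc n D' = trunc n D /\ lco D' r k <> lco D r k) /\
     (exists D' : pert C, trunc n D' = trunc n D /\ pco D' r k <> pco D r k)) /\
  (* the indices are fixed at leading order, exactly *)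
  (forall Rp Rm : C,
     (indices (trunc 1 D) r Rp Rm <-> indices (trunc n D) r Rp Rm) /\
     (indices (trunc 1 D) r Rp Rm <-> indices D r Rp Rm)) /\
  (* delta l_n, delta p_n are linear in gamma^[n+1], beta_n *)
  (exists L P : {linear ('M[C]_2 * C^o)%type -> C^o},
     forall D' : pert C, trunc n D' = trunc n D ->
       delta n (fun E => lco E r n) D' = L (unknowns n D') /\
       delta n (fun E => pco E r n) D' = P (unknowns n D')) /\
  (* the Frobenius coefficients, away from R_+ - R_- = 1, 2, ... *)
  (forall Rp Rm : C, indices D r Rp Rm ->
     (forall m : nat, (0 < m)%N -> Rp - Rm <> m%:R) ->
     Fpol D r (Rp + n%:R) = n%:R * (n%:R + (Rp - Rm)) /\
     Fpol D r (Rm + n%:R) = n%:R * (n%:R - (Rp - Rm)) /\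
     (forall R : C, R = Rp \/ R = Rm ->
        (forall i : nat, (i < n)%N ->
           Acoef (trunc n D) r R i = Acoef D r R i) /\
        (* A_n differs from the exact one, off the zero set of a nonzero
           linear form in the unknowns gamma^[n+1], beta_n *)
        (exists dA : {linear ('M[C]_2 * C^o)%type -> C^o},
           (exists X : 'M[C]_2 * C^o, dA X <> 0) /\
           (forall D' : pert C, trunc n D' = trunc n D ->
              (Acoef (trunc n D) r R n <> Acoef D' r R n <->
               dA (unknowns n D') <> 0))) /\
        (* the next order determines A_n *)
        Acoef (trunc n.+1 D) r R n = Acoef D r R n /\
        delta n (fun E => Acoef E r R n) D / Acoef (trunc n D) r R 0
        = - ((R * delta n (fun E => lco E r n) D
              + delta n (fun E => pco E r n) D) / Fpol D r (R + n%:R)))).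
Proof.
have b0 : bet D 0 != 0 by rewrite gt_eqF.
have g0 := gamma1_offdiag r.
have gb0 : - (gam D 0 r (other r) / bet D 0 ^+ 2) != 0.
  by rewrite oppr_eq0 mulf_neq0 // invr_eq0 expf_neq0.
have lcoT k : (k < n)%N -> lco (trunc n D) r k = lco D r k.
  by move=> lt_kn; apply: lco_local => i lt_ik; apply: agree_truncl; rewrite (leq_trans lt_ik).
have pcoT k : (k < n)%N -> pco (trunc n D) r k = pco D r k.
  by move=> lt_kn; apply: pco_local => i lt_ik; apply: agree_truncl; rewrite (leq_trans lt_ik).
have lcoTS k : (k <= n)%N -> lco (trunc n.+1 D) r k = lco D r k.
  by move=> le_kn; apply: lco_local => i lt_ik; apply: agree_truncl; rewrite (leq_trans lt_ik).
have pcoTS k : (k <= n)%N -> pco (trunc n.+1 D) r k = pco D r k.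
  by move=> le_kn; apply: pco_local => i lt_ik; apply: agree_truncl; rewrite (leq_trans lt_ik).
have lco1 : lco (trunc 1 D) r 0 = lco D r 0 by apply: lco_local; exact: agree_truncl.
have pco1 : pco (trunc 1 D) r 0 = pco D r 0 by apply: pco_local; exact: agree_truncl.
split; [|split; [|split; [|split; [|split; [|split; [|split]]]]]].
- by move=> m; split; [exact: lambdaF_expansion|exact: phiF_expansion].
(* Both truncations are expanded up to [a^n], where their partial sums coincide and cancel. *)
- have := is_OD (lambdaF_expansion (ltn0Sn n) b0 g0 n)
                (is_ON (lambdaF_expansion n_ge1 b0 g0 n)).
  congr (is_O n _); apply/funext => a.
  have -> : \sum_(k < n) lco (trunc n.+1 D) r k * a ^+ k
          = \sum_(k < n) lco (trunc n D) r k * a ^+ k.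
    by apply: eq_bigr => k _; rewrite (lcoTS _ (ltnW (ltn_ord k))) (lcoT _ (ltn_ord k)).
  ring.
- have := is_OD (phiF_expansion r (ltn0Sn n) b0 n) (is_ON (phiF_expansion r n_ge1 b0 n)).
  congr (is_O n _); apply/funext => a.
  have -> : \sum_(k < n) pco (trunc n.+1 D) r k * a ^+ k
          = \sum_(k < n) pco (trunc n D) r k * a ^+ k.
    by apply: eq_bigr => k _; rewrite (pcoTS _ (ltnW (ltn_ord k))) (pcoT _ (ltn_ord k)).
  ring.
- by move=> k lt_kn; split; [exact: lcoT|exact: pcoT].
- move=> k le_nk; have k0 : (0 < k)%N := leq_trans n_ge1 le_nk.
  split; [exists (perturb k (delta_mx (other r) (other r)) D)
         |exists (perturb k (delta_mx (other r) r) D)];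
    (split; first exact: trunc_perturb); apply/eqP; rewrite -subr_eq0.
    by rewrite (lco_perturb _ k0 b0 g0) lco_form_diag invr_eq0.
  by rewrite (pco_perturb _ _ k0 b0) pco_form_offdiag.
- move=> Rp Rm; rewrite /indices (lcoT _ n_ge1) (pcoT _ n_ge1) lco1 pco1; split; exact: iff_refl.
- exists (lco_form D n r), (pco_form D r) => D' D'D.
  by split; [exact: lco_delta|exact: pco_delta].
move=> Rp Rm ind nonres.
split; first exact: indicial_Rp ind.
split; first exact: indicial_Rm ind.
move=> R RE; have F0 := indicial_shift_neq0 n_ge1 ind (nonres _ n_ge1) RE.
(* Uniform in the completion [D']: used for the comparison with the exact coefficient and, at
   [trunc n.+1 D], for [delta]. *)
have AE D' : trunc n D' = trunc n D ->
    Acoef D' r R n - Acoef (trunc n D) r R n =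
    - ((R * (lco D' r n - lco (trunc n D) r n) + (pco D' r n - pco (trunc n D) r n))
       / Fpol D r (R + n%:R)).
  move=> D'D; rewrite /Fpol -(lcoT _ n_ge1) -(pcoT _ n_ge1).
  have DD' : agree n (trunc n D) D' by rewrite -D'D; exact: agree_truncl.
  apply: (frobenius_top R n_ge1) => i lt_in.
  by split; [apply: lco_local|apply: pco_local] => j lt_ji;
    apply: DD'; exact: leq_trans lt_ji lt_in.
split; last split; last split.
- move=> i lt_in; apply: frobenius_local => j le_ji.
  have lt_jn := leq_ltn_trans le_ji lt_in.
  by split; [exact: lcoT|exact: pcoT].
- exists (R \*: lco_form D n r \+ pco_form D r).
  split.
    exists (delta_mx (other r) r, 0); apply/eqP.
    rewrite /= /GRing.add_fun /= lco_form_offdiag pco_form_offdiag scaler0 add0r.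
    exact: gb0.
  move=> D' D'D.
  rewrite -[X in _ <-> X <> 0]/(R * lco_form D n r (unknowns n D') + pco_form D r (unknowns n D')).
  have := AE _ D'D; rewrite (lco_next n_ge1 b0 g0 D'D) (pco_next r n_ge1 b0 D'D).
  (* The difference of the two coefficients is [- (x / F(R + n))]; as [F(R + n)] is nonzero, it
     vanishes only with [x]. *)
  move: (R * _ + _) => x AD; split=> ne e; apply: ne.
    by apply/esym/eqP; rewrite -subr_eq0 AD e mul0r oppr0.
  apply/eqP; move/esym/eqP: e; rewrite -subr_eq0 AD oppr_eq0 mulf_eq0 invr_eq0.
  by rewrite (negbTE F0) orbF.
- apply: frobenius_local => i le_in.
  by split; [exact: lcoTS|exact: pcoTS].
- rewrite {1}/delta (AE _ (trunc_truncS n D)) /Acoef frobeniusE divr1; exact: erefl.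
Qed.
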